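(* Let $n\ge 2$. Among all octagonal chains with $n$ octagons, the linear octagonal chain $L_n=O(\underbrace{2,2,\ldots,2}_{n-2})$ is the unique chain (up to graph isomorphism) with maximum Kirchhoff index; that is, every octagonal chain $O(w)$, $w\in\{0,1,2,3,4\}^{n-2}$, satisfies $Kf(O(w))\le Kf(L_n)$, with equality only if $O(w)$ is isomorphic to $L_n$.
   Context: Resistance distance and Kirchhoff index: for a finite simple connected graph $G$, the resistance distance $r_G(u,v)$ between vertices $u,v$ is the effective resistance between $u$ and $v$ in the electrical network obtained from $G$ by replacing each edge with a unit resistor. The Kirchhoff index is $Kf(G)=\sum_{\{u,v\}\subseteq V(G)} r_G(u,v)$, the sum over all unordered pairs of distinct vertices. Octagonal chains: for $n\ge 2$ let $Q_n$ be the ladder graph with $n$ squares, with top vertices $a_0,a_1,\ldots,a_n$, bottom vertices $c_0,c_1,\ldots,c_n$, rungs $a_jc_j$ ($0\le j\le n$), top edges $a_{j-1}a_j$ and bottom edges $c_{j-1}c_j$ ($1\le j\le n$). Its $j$-th square $S_j$ has vertices $a_{j-1},a_j,c_j,c_{j-1}$. An octagonal chain with $n$ octagons is obtained from $Q_n$ by adding four new vertices to each square: for each $j$, the top edge of $S_j$ is subdivided by some number $k\in\{0,1,2,3,4\}$ of new vertices and the bottom edge of $S_j$ is subdivided by the remaining $4-k$ new vertices, so that $S_j$ becomes an octagon. By convention, in $S_1$ and $S_n$ all four new vertices are put on the bottom edge. For a vector $w=(w_1,\ldots,w_{n-2})$ with entries in $\{0,1,2,3,4\}$, $O(w)$ denotes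 the octagonal chain with $n$ octagons in which, for $1\le i\le n-2$, exactly $w_i$ new vertices are put on the top edge of $S_{i+1}$ and $4-w_i$ on its bottom edge. Every octagonal chain with $n$ octagons is represented as $O(w)$ for some such $w$ (up to isomorphism; for $n=2$ the vector is empty). *)

(* Defs.v *)
From HB Require Import structures.
From mathcomp Require Import all_boot all_order all_algebra.
From mathcomp Require Import boolp classical_sets.
From mathcomp Require Import zify ring lra.

Set Implicit Arguments.
Unset Strict Implicit.
Unset Printing Implicit Defensive.

Import Order.TTheory GRing.Theory Num.Theory.
Local Open Scope ring_scope.

Record sgraph := SGraph {
  vertex :> finType;
  adj : rel vertex;
  adj_sym : symmetric adj;
  adj_irr : irreflexive adj }.

Definition isomorphic (G H : sgraph) : Prop :=
  exists2 f : G -> H, bijective f & forall x y, adj (f x) (f y) = adj x y.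

Definition connected (G : sgraph) : Prop := forall x y : G, connect (@adj G) x y.

Section Resistance.
Variables (R : realFieldType) (G : sgraph).

(* By Ohm's law the potential phi drives the current phi x - phi y along the
   unit resistor xy; Kirchhoff's current law then says that a unit current
   enters the network at u and leaves it at v. *)
Definition unit_current (u v : G) (phi : G -> R) : Prop :=
  forall x, \sum_(y | adj x y) (phi x - phi y) = (x == u)%:R - (x == v)%:R.

(* The value 0 is a junk default, used only if there is no such potential
   (i.e. u and v lie in different components). *)
Definition resistance (u v : G) : R :=
  xget 0 [set r | exists2 phi, unit_current u v phi & r = phi u - phi v]%classic.

(* Each unordered pair of distinct vertices is counted once, as the ordered
   pair (u, v) with u before v in the enumeration of G. *)
Definition kirchhoff_index : R :=
  \sum_u \sum_(v | (enum_rank u < enum_rank v)%N) resistance u v.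

Lemma resistanceC u v : resistance u v = resistance v u.
Proof.
rewrite /resistance; congr xget; apply/seteqP.
suff sub a b : ([set r | exists2 phi, unit_current a b phi & r = phi a - phi b]
   `<=` [set r | exists2 phi, unit_current b a phi & r = phi b - phi a])%classic.
  by split; apply: sub.
move=> r [phi phiP ->]; exists (fun x => - phi x); last by rewrite opprK addrC.
move=> x; rewrite -opprB -phiP -sumrN; apply: eq_bigr => y _; ring.
Qed.

Let energyE (f : G -> R) :
  \sum_x f x * (\sum_(y | adj x y) (f x - f y)) *+ 2 =
  \sum_x \sum_(y | adj x y) (f x - f y) ^+ 2.
Proof.
rewrite sumrMnl mulr2n.
under eq_bigr do rewrite mulr_sumr.
rewrite {2}(exchange_big_dep xpredT) //= -big_split /=; apply: eq_bigr => x _.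
rewrite [X in _ + X](eq_bigl (adj x)); last by move=> y; rewrite adj_sym.
rewrite -big_split; apply: eq_bigr => y _ /=; ring.
Qed.

Let harmonic_const (f : G -> R) : connected G ->
  (\sum_x f x * (\sum_(y | adj x y) (f x - f y)) = 0) -> forall x y, f x = f y.
Proof.
move=> conG f0 x y.
have step a b : adj a b -> f a = f b.
  move=> ab; have /eqP := energyE f; rewrite sumrMnl f0 mul0rn eq_sym.
  rewrite psumr_eq0; last by move=> i _; apply: sumr_ge0 => j _; apply: sqr_ge0.
  move=> /allP/(_ a (mem_index_enum a))/=.
  rewrite psumr_eq0; last by move=> j _; apply: sqr_ge0.
  move=> /allP/(_ b (mem_index_enum b)); rewrite ab /= sqrf_eq0 subr_eq0.
  by move/eqP.
have /connectP[p] := conG x y.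
by elim: p x => [|z p IHp] x /=; [move=> _ -> | move=> /andP[/step-> /IHp]].
Qed.

Lemma unit_current_unique u v phi psi : connected G ->
  unit_current u v phi -> unit_current u v psi ->
  phi u - phi v = psi u - psi v.
Proof.
move=> conG phiP psiP.
have fE : forall x y, phi x - psi x = phi y - psi y.
  apply: harmonic_const => //; apply: big1 => x _.
  rewrite (eq_bigr (fun y => (phi x - phi y) - (psi x - psi y))).
    by rewrite sumrB phiP psiP subrr mulr0.
  by move=> y _; ring.
have := fE u v; lra.
Qed.

(* The Laplacian L maps phi to the current x |-> \sum_(y ~ x) (phi x - phi y).
   On a connected graph L + J is injective, J the all-ones matrix. *)
Lemma unit_current_exists u v : connected G -> exists phi, unit_current u v phi.
Proof.
move=> conG; pose ev := @enum_val G predT.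
pose M : 'M[R]_#|G| := \matrix_(k, i)
  (\sum_(y | adj (ev i) y) ((ev i == ev k)%:R - (y == ev k)%:R) + 1).
have pick (f : G -> R) z : \sum_x f x * (z == x)%:R = f z.
  rewrite (bigD1 z) //= eqxx mulr1 big1 ?addr0 // => x xz.
  by rewrite eq_sym (negPf xz) mulr0.
have ME (h : 'rV_#|G|) x : let f y := h 0 (enum_rank y) in
    (h *m M) 0 (enum_rank x) = \sum_(y | adj x y) (f x - f y) + \sum_y f y.
  move=> f; rewrite mxE (reindex enum_rank) /=; last first.
    by exists enum_val => y _; rewrite ?enum_valK ?enum_rankK.
  under eq_bigr do rewrite mxE /ev !enum_rankK mulrDr mulr1 mulr_sumr.
  rewrite big_split /= exchange_big /=; congr (_ + _).
  apply: eq_bigr => y _; under eq_bigr do rewrite mulrBr.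
  by rewrite sumrB !pick.
have div0 (f : G -> R) : \sum_x \sum_(y | adj x y) (f x - f y) = 0.
  under eq_bigr do rewrite sumrB.
  rewrite sumrB [X in _ - X](exchange_big_dep xpredT) //=.
  apply/eqP; rewrite subr_eq0; apply/eqP/eq_bigr => x _.
  by apply: eq_bigl => y; rewrite adj_sym.
have sum0 (f g : G -> R) : \sum_x g x = 0 ->
    (forall x, \sum_(y | adj x y) (f x - f y) + \sum_y f y = g x) ->
    \sum_y f y = 0.
  move=> g0 fg; have /eqP : \sum_(x : G) \sum_y f y = 0.
    by rewrite -[RHS]g0 -(eq_bigr _ (fun x _ => fg x)) big_split /= div0 add0r.
  rewrite sumr_const mulrn_eq0 => /orP[/eqP/card0_eq G0|/eqP//].
  by have := G0 u; rewrite inE.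
have Munit : M \in unitmx.
  rewrite -row_free_unit -kermx_eq0; apply/eqP/row_matrixP => i; rewrite row0.
  pose phi := row i (kermx M); pose f y := phi 0 (enum_rank y).
  have phiM : phi *m M = 0 by rewrite -row_mul mulmx_ker row0.
  have fM x : \sum_(y | adj x y) (f x - f y) + \sum_y f y = 0.
    by rewrite -ME phiM mxE.
  have f0 : \sum_y f y = 0 by apply: (sum0 f (fun=> 0)) => //; apply: big1.
  have fc : forall x y, f x = f y.
    apply: harmonic_const => //; apply: big1 => x _.
    by have := fM x; rewrite f0 addr0 => ->; rewrite mulr0.
  apply/rowP => k; rewrite [RHS]mxE -(enum_valK k) -/(f _).
  move/eqP: f0; rewrite (eq_bigr (fun=> f (enum_val k))); last by move=> *.
  rewrite sumr_const mulrn_eq0 => /orP[/eqP/card0_eq G0|/eqP//].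
  by have := G0 u; rewrite inE.
pose b : 'rV[R]_#|G| := \row_i ((ev i == u)%:R - (ev i == v)%:R).
pose psi := b *m invmx M; pose f y := psi 0 (enum_rank y).
have fM x : \sum_(y | adj x y) (f x - f y) + \sum_y f y
    = (x == u)%:R - (x == v)%:R.
  by rewrite -ME mulmxKV // mxE /ev enum_rankK.
exists f => x; rewrite -fM (sum0 _ _ _ fM) ?addr0 // sumrB.
have one z : \sum_(y : G) (y == z)%:R = 1 :> R.
  by rewrite -[RHS](pick (fun=> 1) z); apply: eq_bigr => y _; rewrite mul1r eq_sym.
by rewrite !one subrr.
Qed.

Lemma resistanceE u v phi : connected G -> unit_current u v phi ->
  resistance u v = phi u - phi v.
Proof.
move=> conG phiP; apply: xget_unique; first by exists phi.
by move=> r [psi psiP ->]; apply: unit_current_unique psiP phiP.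
Qed.

End Resistance.

Section OctagonalChain.
Variable n : nat.

(* The ladder vertices a_0 .. a_n and c_0 .. c_n, and four new vertices for each
   of the n squares. *)
Definition chain_vertex : finType := ('I_n.+1 + 'I_n.+1 + 'I_n * 'I_4)%type.

Definition top_vertex (i : 'I_n.+1) : chain_vertex := inl (inl i).
Definition bot_vertex (i : 'I_n.+1) : chain_vertex := inl (inr i).
Definition new_vertex (j : 'I_n) (k : 'I_4) : chain_vertex := inr (j, k).

Definition left_end (j : 'I_n) : 'I_n.+1 := widen_ord (leqnSn n) j.
Definition right_end (j : 'I_n) : 'I_n.+1 := lift ord0 j.

Variable t : 'I_n -> 'I_5.

(* Squares are indexed from 0. In square j the new vertices 0 .. t j - 1
   subdivide the top edge and the new vertices t j .. 3 the bottom edge, in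
   this order from left to right. *)
Definition top_path (j : 'I_n) : seq chain_vertex :=
  top_vertex (left_end j) ::
  rcons [seq new_vertex j k | k : 'I_4 <- enum 'I_4 & (k < t j)%N]
        (top_vertex (right_end j)).
Definition bot_path (j : 'I_n) : seq chain_vertex :=
  bot_vertex (left_end j) ::
  rcons [seq new_vertex j k | k : 'I_4 <- enum 'I_4 & (t j <= k)%N]
        (bot_vertex (right_end j)).

Definition consecutive (s : seq chain_vertex) (x y : chain_vertex) : bool :=
  (x, y) \in zip s (behead s).

Definition chain_arc (x y : chain_vertex) : bool :=
  [exists i, (x == top_vertex i) && (y == bot_vertex i)] ||
  [exists j, consecutive (top_path j) x y || consecutive (bot_path j) x y].

Definition chain_adj : rel chain_vertex :=
  fun x y => chain_arc x y || chain_arc y x.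

Lemma chain_adj_sym : symmetric chain_adj.
Proof. by move=> x y; rewrite /chain_adj orbC. Qed.

Lemma chain_adj_irr : irreflexive chain_adj.
Proof.
have cons_irr s x : uniq s -> consecutive s x x = false.
  rewrite /consecutive; case: s => // y s; elim: s y => [|z s IHs] y //=.
  move=> /andP[yNs us]; rewrite in_cons IHs // orbF.
  by apply/eqP => -[xy xz]; rewrite -xy xz mem_head in yNs.
move=> x; rewrite /chain_adj orbb; apply/negbTE; rewrite negb_or; apply/andP.
split; first by apply/existsPn => i; apply/negP => /andP[/eqP->].
have neq_ends j : (left_end j == right_end j) = false.
  by apply/negbTE; rewrite -val_eqE /= /bump; lia.
have uniq_new j P : uniq [seq new_vertex j k | k : 'I_4 <- enum 'I_4 & P k].
  rewrite map_inj_uniq; first by rewrite filter_uniq // enum_uniq.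
  by move=> k l [].
have notin_new j P y : inl y \notin [seq new_vertex j k | k : 'I_4 <- enum 'I_4 & P k].
  by apply/mapP => -[].
apply/existsPn => j; rewrite !cons_irr //=;
by rewrite rcons_uniq mem_rcons in_cons uniq_new !(negPf (notin_new _ _ _))
           !orbF andbT /= -[_ == _]/(left_end j == right_end j) neq_ends.
Qed.

Definition subdivided_ladder : sgraph := SGraph chain_adj_sym chain_adj_irr.

Lemma subdivided_ladder_connected : connected subdivided_ladder.
Proof.
have pathW x p : (forall y z, consecutive (x :: p) y z -> chain_adj y z) ->
    path chain_adj x p.
  elim: p x => //= a p IHp x xp; apply/andP; split.
    by apply: xp; rewrite /consecutive mem_head.
  by apply: IHp => y z yz; apply: xp; rewrite /consecutive in_cons; apply/orP; right.
pose r := connect chain_adj (top_vertex ord0).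
have symr : connect_sym chain_adj by apply: sym_connect_sym; apply: chain_adj_sym.
have top_adj j y z : consecutive (top_path j) y z -> chain_adj y z.
  move=> yz; apply/orP; left; apply/orP; right; apply/existsP; exists j.
  by rewrite yz.
have bot_adj j y z : consecutive (bot_path j) y z -> chain_adj y z.
  move=> yz; apply/orP; left; apply/orP; right; apply/existsP; exists j.
  by rewrite yz orbT.
have top_con j x : x \in top_path j -> connect chain_adj (top_vertex (left_end j)) x.
  exact: (path_connect (pathW _ _ (@top_adj j))).
have bot_con j x : x \in bot_path j -> connect chain_adj (bot_vertex (left_end j)) x.
  exact: (path_connect (pathW _ _ (@bot_adj j))).
have rtop i : r (top_vertex i).
  case: i => i; elim: i => [|i IHi] lti.
    by rewrite (_ : Ordinal lti = ord0) /r ?connect0 //; apply: val_inj.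
  have ltin : (i < n)%N by [].
  rewrite (_ : Ordinal lti = right_end (Ordinal ltin)); last exact: val_inj.
  apply: connect_trans (IHi (ltnW lti)) _.
  rewrite (_ : Ordinal (ltnW lti) = left_end (Ordinal ltin)); last exact: val_inj.
  by apply: top_con; rewrite in_cons mem_rcons mem_head orbT.
have rbot i : r (bot_vertex i).
  apply: connect_trans (rtop i) (connect1 _); apply/orP; left; apply/orP; left.
  by apply/existsP; exists i; rewrite !eqxx.
have rall x : r x.
  case: x => [[i|i]|[j k]]; [exact: rtop | exact: rbot |].
  have [kt|tk] := ltnP k (t j).
    apply: connect_trans (rtop (left_end j)) (top_con j _ _).
    rewrite in_cons mem_rcons in_cons; apply/orP; right; apply/orP; right.
    by apply/mapP; exists k; rewrite // mem_filter kt mem_enum.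
  apply: connect_trans (rbot (left_end j)) (bot_con j _ _).
  rewrite in_cons mem_rcons in_cons; apply/orP; right; apply/orP; right.
  by apply/mapP; exists k; rewrite // mem_filter tk mem_enum.
by move=> x y; apply: connect_trans (rall y); rewrite symr; apply: rall.
Qed.

End OctagonalChain.

(* [nth ord0 (ord0 :: rcons w ord0)] lists the numbers of new top vertices of
   all n squares: w on the inner ones, 0 on the first and the last one. *)
Definition octagonal_chain (n : nat) (w : (n - 2).-tuple 'I_5) : sgraph :=
  subdivided_ladder (fun j : 'I_n => nth ord0 (ord0 :: rcons w ord0) j).
Arguments octagonal_chain : clear implicits.

Definition linear_chain (n : nat) : sgraph :=
  octagonal_chain n (nseq_tuple (n - 2) (@Ordinal 5 2 isT)).

(* Main.v *)
(* The energy of a unit flow from u to v is least when the flow is orthogonal to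
   all cycles, and then it is the resistance. In a chain of octagons the Gram
   matrix of the n square loops is tridiagonal with 8 on the diagonal and -1 next
   to it, whatever the shape of the chain. So if f x is a unit flow into x from a
   common source, c x its inner products with the loops and N the inverse Gram
   matrix, the kernel K x y = <f x, f y> - (c x)^T N (c y) determines all
   resistances, and the Kirchhoff index is |V| * sum_x K x x - sum_(x, y) K x y.
   Let s_j be the number of new top vertices of square j, minus 2. Summing over
   the vertices gives, with squares numbered from 0,
     Kf = K_n - (sum_(i, j) s_i s_j x_(min i j) x_(n-1 - max i j)) / u_(n+1),
   where u_0 = 0, u_1 = 1, u_(k+2) = 8 u_(k+1) - u_k and x_i = 6 i u_(i+1) + u_i.
   Since x increases from x_0 = 0, the form is a combination with positive
   coefficients of the squares of the partial sums of the x_i s_i; it does not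
   involve s_0 and s_(n-1), and it vanishes only if all other s_i do. *)

Require Import Defs.
From mathcomp Require Import all_boot all_order all_algebra.
From mathcomp Require Import zify ring lra.

Set Implicit Arguments.
Unset Strict Implicit.
Unset Printing Implicit Defensive.

Import Order.TTheory GRing.Theory Num.Theory.
Local Open Scope ring_scope.

(** * Green kernels of finite networks *)

Section Kernel.
Variables (R : realFieldType) (G : sgraph).

Lemma kirchhoff_index_pairs : connected G ->
  kirchhoff_index R G *+ 2 = \sum_(u : G) \sum_(v : G) resistance R u v.
Proof.
move=> conG; rewrite /kirchhoff_index mulr2n {2}(exchange_big_dep xpredT) //=.
rewrite -big_split; apply: eq_bigr => u _ /=.
rewrite [RHS](bigID (fun v => enum_rank u < enum_rank v)%N) /=; congr (_ + _).
rewrite [RHS](bigID (pred1 u)) /= [X in _ = X + _]big1 ?add0r; last first.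
  move=> v /andP[_ /eqP->]; have [phi phiP] := unit_current_exists R u u conG.
  by rewrite (resistanceE conG phiP) subrr.
rewrite (eq_bigr (fun v => resistance R u v)) => [|v _]; last exact: resistanceC.
apply: eq_bigl => v; rewrite -leqNgt ltn_neqAle andbC; congr (_ && _).
by rewrite (inj_eq val_inj) (inj_eq enum_rank_inj).
Qed.

Variables (E : finType) (src tgt : E -> G).
Hypothesis adjE : forall x y : G, (adj x y)%:R =
  \sum_e ((src e == x) && (tgt e == y))%:R +
  \sum_e ((src e == y) && (tgt e == x))%:R :> R.

(** The Laplacian factors through the oriented incidence matrix of the arcs: gradient first, then
    divergence at [x]. *)
Lemma sum_adj x (F : G -> R) : \sum_(y | adj x y) (F x - F y) =
  \sum_e (F (tgt e) - F (src e)) * ((x == tgt e)%:R - (x == src e)%:R).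
Proof.
have pick e (h : E -> G) : \sum_y (h e == y)%:R * F y = F (h e).
  rewrite (bigD1 (h e)) //= eqxx mul1r big1 ?addr0 // => y.
  by rewrite eq_sym => /negPf->; rewrite mul0r.
transitivity (\sum_e (x == src e)%:R * \sum_y (tgt e == y)%:R * (F x - F y) +
              \sum_e (x == tgt e)%:R * \sum_y (src e == y)%:R * (F x - F y)).
  rewrite big_mkcond; under [X in _ = X + _]eq_bigr do rewrite mulr_sumr.
  under [X in _ = _ + X]eq_bigr do rewrite mulr_sumr.
  rewrite exchange_big [X in _ = _ + X]exchange_big -big_split.
  apply: eq_bigr => y _ /=.
  have -> : (if adj x y then F x - F y else 0) = (adj x y)%:R * (F x - F y).
    by case: adj; rewrite (mul1r, mul0r).
  rewrite adjE mulrDl !mulr_suml; congr (_ + _); apply: eq_bigr => e _.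
    by rewrite mulrA -natrM mulnb eq_sym.
  by rewrite mulrA -natrM mulnb andbC; rewrite (eq_sym x).
rewrite -big_split; apply: eq_bigr => e _ /=.
have pickB h : \sum_y (h e == y)%:R * (F x - F y) = F x - F (h e).
  under eq_bigr do rewrite mulrBr.
  rewrite sumrB pick -mulr_suml (bigD1 (h e)) //= eqxx big1 ?addr0 ?mul1r //.
  by move=> y; rewrite eq_sym => /negPf->.
by rewrite !pickB; case: eqP => [->|_]; case: eqP => [->|_] /=; ring.
Qed.

Lemma adj_step (T : Type) (F : G -> T) : connected G ->
  (forall e, F (src e) = F (tgt e)) -> forall x y, F x = F y.
Proof.
move=> conG Fe x y; have step a b : adj a b -> F a = F b.
  move=> ab; have := adjE a b; rewrite ab.
  case: (pickP (fun e => (src e == a) && (tgt e == b))) => [e /andP[/eqP<- /eqP<-] //|e0].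
  case: (pickP (fun e => (src e == b) && (tgt e == a))) => [e /andP[/eqP<- /eqP<-] //|e1].
  rewrite !big1 => [|e _|e _]; rewrite ?e0 ?e1 // addr0 => /eqP.
  by rewrite oner_eq0.
have /connectP[p] := conG x y.
by elim: p x => [|z p IHp] x /=; [move=> _ -> | move=> /andP[/step-> /IHp]].
Qed.

Variables f g : G -> E -> R.
(** [g_arc]: the flow [g (tgt e) - g (src e)] has the same divergence as the single arc [e].
    [fg_arc]: in the pairing with [g x], the difference [f (tgt e) - f (src e)] also acts like the
    arc [e]. This is the case when it differs from [e] by cycles and [g x] is orthogonal to
    cycles. *)
Hypothesis g_arc : forall e (psi : G -> R),
  \sum_e' (g (tgt e) e' - g (src e) e') * (psi (tgt e') - psi (src e')) =
  psi (tgt e) - psi (src e).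
Hypothesis fg_arc : forall x e,
  \sum_e' (f (tgt e) e' - f (src e) e') * g x e' = g x e.

(** By [g_arc] the pairing of [g x] with the gradient of [psi] differs from [psi x] by a quantity
    that is the same at both ends of every arc, hence constant. *)
Lemma flow_div (psi : G -> R) u v : connected G ->
  \sum_e (g u e - g v e) * (psi (tgt e) - psi (src e)) = psi u - psi v.
Proof.
move=> conG; pose F x := \sum_e g x e * (psi (tgt e) - psi (src e)) - psi x.
have : F u = F v.
  apply: adj_step => // e; have := g_arc e psi; rewrite /F.
  by under eq_bigr do rewrite mulrBl; rewrite sumrB; lra.
rewrite /F => Fuv; under eq_bigr do rewrite mulrBl.
by rewrite sumrB; lra.
Qed.

Let K x y := \sum_e f x e * g y e.

(* [fun x => K x u - K x v] is the potential whose gradient is the flow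
   [g u - g v]. *)
Lemma kernel_resistance (u v : G) : connected G ->
  resistance R u v = K u u - K u v - K v u + K v v.
Proof.
move=> conG; rewrite (@resistanceE _ _ u v (fun x => K x u - K x v)) //.
  ring.
move=> x; rewrite sum_adj.
have KE w e : K (tgt e) w - K (src e) w = g w e.
  by rewrite -fg_arc /K -sumrB; apply: eq_bigr => e' _; rewrite mulrBl.
rewrite -(flow_div (fun y => (x == y)%:R) u v conG).
by apply: eq_bigr => e _; rewrite -!KE; ring.
Qed.

Lemma kernel_kirchhoff_index : connected G ->
  kirchhoff_index R G = #|G|%:R * (\sum_x \sum_e f x e * g x e)
                        - \sum_e (\sum_x f x e) * (\sum_x g x e).
Proof.
move=> conG; have KK : \sum_x \sum_y K x y =
    \sum_e (\sum_x f x e) * (\sum_x g x e).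
  rewrite /K; under eq_bigr do rewrite exchange_big.
  rewrite exchange_big; apply: eq_bigr => e _ /=.
  by rewrite mulr_suml; apply: eq_bigr => x _; rewrite mulr_sumr.
have KC : \sum_x \sum_y K y x = \sum_x \sum_y K x y by rewrite exchange_big.
have card (F : R) : \sum_(x : G) F = #|G|%:R * F by rewrite sumr_const mulr_natl.
suff : kirchhoff_index R G *+ 2 = (#|G|%:R * (\sum_x K x x) - \sum_x \sum_y K x y) *+ 2.
  by rewrite KK => /(pmulrnI (isT : (0 < 2)%N)) ->.
rewrite kirchhoff_index_pairs //.
under eq_bigr do under eq_bigr do rewrite kernel_resistance //.
under eq_bigr do rewrite !big_split /= !sumrN card.
rewrite !big_split /= !sumrN card -mulr_sumr KC; ring.
Qed.

End Kernel.

(** * The inverse Gram matrix *)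

Section Green.
Variable R : realFieldType.

(* [cheb k.+1] is the Chebyshev polynomial of the second kind U_k at 4. *)
Fixpoint cheb (k : nat) : R :=
  if k is k'.+1 then if k' is k''.+1 then 8 * cheb k' - cheb k'' else 1 else 0.
Arguments cheb k : simpl never.

Lemma chebSS k : cheb k.+2 = 8 * cheb k.+1 - cheb k. Proof. by []. Qed.

Lemma cheb_lt k : 0 <= cheb k < cheb k.+1.
Proof.
elim: k => [|k /andP[c0 c1]]; first by rewrite /cheb lexx ltr01.
by rewrite chebSS; apply/andP; split; lra.
Qed.

Lemma cheb_gt0 k : 0 < cheb k.+1.
Proof. by case/andP: (cheb_lt k) => c0 /(le_lt_trans c0). Qed.

(** The addition formula of the Chebyshev polynomials. It normalizes [green] on the diagonal and
    later eliminates [cheb n.+1]. *)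
Lemma chebD a b : cheb a.+1 * cheb b.+1 - cheb a * cheb b = cheb (a + b).+1.
Proof.
elim: a b => [|a IHa] b; first by rewrite mul1r mul0r subr0.
rewrite addSnnS -IHa !chebSS. ring.
Qed.

Variable n : nat.

(* The inverse of the n x n tridiagonal matrix with 8 on the diagonal and -1
   next to it. Indices run from 1 to n; the boundary values at 0 and n.+1
   are 0. *)
Definition green (a b : nat) : R :=
  cheb (minn a b) * cheb (n.+1 - maxn a b) / cheb n.+1.

Lemma greenC a b : green a b = green b a.
Proof. by rewrite /green minnC maxnC. Qed.

Lemma green0 b : green 0 b = 0.
Proof. by rewrite /green min0n /= !mul0r. Qed.

Lemma greenS b : (b <= n.+1)%N -> green n.+1 b = 0.
Proof. by move=> bn; rewrite /green (maxn_idPl bn) subnn /= mulr0 mul0r. Qed.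

Lemma green_le a b : (a <= b)%N ->
  green a b = cheb a * cheb (n.+1 - b) / cheb n.+1.
Proof. by move=> ab; rewrite /green (minn_idPl ab) (maxn_idPr ab). Qed.

Lemma green_inv a b : (a < n)%N -> (b < n)%N ->
  8 * green a.+1 b.+1 - green a b.+1 - green a.+2 b.+1 = (a == b)%:R.
Proof.
move=> an bn; have c0 : cheb n.+1 != 0 by rewrite gt_eqF ?cheb_gt0.
case: (ltngtP a b) => [ab|ba|<-].
- rewrite !green_le ?chebSS //; [by rewrite mulr0n; field | lia | lia].
- rewrite !(greenC _ b.+1) !green_le; [| lia | lia | lia].
  have [-> [-> ->]] : (n.+1 - a = (n - a.+1).+2 /\ n.+1 - a.+1 = (n - a.+1).+1 /\
    n.+1 - a.+2 = n - a.+1)%N by lia.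
  by rewrite chebSS mulr0n; field.
rewrite (greenC a.+2) !green_le //.
have -> : (n.+1 - a.+2 = n - a.+1)%N by lia.
have -> : (n.+1 - a.+1 = (n - a.+1).+1)%N by lia.
have E : cheb n.+1 = cheb (a.+1 + (n - a.+1)).+1 by congr cheb; lia.
have := chebD a.+1 (n - a.+1); rewrite -E chebSS => D.
by apply: (mulIf c0); rewrite mulr1n mul1r -[RHS]D; field.
Qed.

Definition wt (i : nat) : R := (6 * i)%:R * cheb i.+1 + cheb i.

Lemma wt0 : wt 0 = 0. Proof. by rewrite /wt muln0 mul0r add0r. Qed.

Lemma wt_lt i : wt i < wt i.+1.
Proof.
rewrite /wt chebSS; have := cheb_lt i; have := cheb_lt i.+1; rewrite chebSS.
have : (0 : R) <= i%:R by rewrite ler0n.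
rewrite !natrM -natr1; nra.
Qed.

Lemma wt_gt0 i : 0 < wt i.+1.
Proof.
elim: i => [|i IHi]; first by rewrite -wt0 wt_lt.
exact: lt_trans (wt_lt _).
Qed.

End Green.
Arguments cheb R k : clear implicits, simpl never.
Arguments wt : clear implicits.

(** * Positivity of the quadratic form *)

Section QuadraticForm.
Variable R : realFieldType.

(* A kernel [x (min i j) * y (max i j)] with [y / x] decreasing is a positive
   combination of squares of partial sums. *)
Lemma single_pair_form (x y z : nat -> R) k : x 0 = 0 ->
    (forall i, 0 < x i.+1) ->
  \sum_(i < k.+2) \sum_(j < k.+2) z i * z j * (x (minn i j) * y (maxn i j)) =
  y k.+1 / x k.+1 * (\sum_(i < k.+2) x i * z i) ^+ 2 +
  \sum_(i < k) (y i.+1 / x i.+1 - y i.+2 / x i.+2) *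
    (\sum_(j < i.+2) x j * z j) ^+ 2.
Proof.
move=> x0 xpos; have xn0 i : x i.+1 != 0 by rewrite gt_eqF.
have step m : \sum_(i < m.+1) \sum_(j < m.+1) z i * z j * (x (minn i j) * y (maxn i j))
  = \sum_(i < m) \sum_(j < m) z i * z j * (x (minn i j) * y (maxn i j))
    + 2 * z m * y m * (\sum_(i < m) x i * z i) + z m ^+ 2 * x m * y m.
  rewrite big_ord_recr /= big_ord_recr /= minnn maxnn.
  under eq_bigr do rewrite big_ord_recr /=.
  rewrite big_split /= -!addrA; congr (_ + _); rewrite !addrA.
  congr (_ + _); last by ring.
  rewrite -big_split mulr_sumr; apply: eq_bigr => i _ /=.
  have im := ltnW (ltn_ord i).
  rewrite (minn_idPl im) (minn_idPr im) (maxn_idPl im) (maxn_idPr im).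
  ring.
elim: k => [|k IHk].
  by rewrite !step !big_ord_recr !big_ord0 /= x0; field.
(* With m = [k.+2], the new row and column contribute [y m / x m * ((X + x m * z m) ^+ 2 - X ^+
   2)]. *)
rewrite step IHk; set X := \sum_(i < k.+2) x i * z i.
rewrite (@big_ord_recr _ _ _ k.+2) (@big_ord_recr _ _ _ k) /= -/X.
by field; rewrite !xn0.
Qed.

Definition wt_form (n : nat) (z : nat -> R) : R :=
  \sum_(i < n) \sum_(j < n) z i * z j * (wt R (minn i j) * wt R (n.-1 - maxn i j)).

(** In [single_pair_form] the square of the full sum has a coefficient with numerator [wt 0 = 0], so
    only proper partial sums remain. *)
Lemma wt_formE k (z : nat -> R) : wt_form k.+2 z =
  \sum_(i < k) (wt R (k.+1 - i.+1) / wt R i.+1 - wt R (k.+1 - i.+2) / wt R i.+2) *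
    (\sum_(j < i.+2) wt R j * z j) ^+ 2.
Proof.
rewrite /wt_form (single_pair_form (x := wt R) (fun i => wt R (k.+1 - i))) ?wt0 //.
  by rewrite subnn wt0 !mul0r add0r.
exact: wt_gt0.
Qed.

Lemma wt_form_coef_gt0 k i : (i < k)%N ->
  0 < wt R (k.+1 - i.+1) / wt R i.+1 - wt R (k.+1 - i.+2) / wt R i.+2.
Proof.
move=> ik; have [-> ->] : (k.+1 - i.+1 = (k - i.+1).+1 /\ k.+1 - i.+2 = k - i.+1)%N by lia.
rewrite subr_gt0 ltr_pdivrMr ?wt_gt0 // mulrAC ltr_pdivlMr ?wt_gt0 //.
have wt_ge0 m : 0 <= wt R m by case: m => [|m]; rewrite ?wt0 // ltW ?wt_gt0.
by apply: ltr_pM; rewrite ?wt_lt.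
Qed.

Lemma wt_form_ge0 n (z : nat -> R) : (1 < n)%N -> 0 <= wt_form n z.
Proof.
case: n => [|[|k]] // _; rewrite wt_formE; apply: sumr_ge0 => i _.
by rewrite mulr_ge0 ?sqr_ge0 // ltW ?wt_form_coef_gt0.
Qed.

(** If all squares vanish, subtracting consecutive partial sums leaves [wt i * z i = 0]. The entry
    [z 0] has weight [wt 0 = 0], and the partial sums stop before [z n.-1]. *)
Lemma wt_form_eq0 n (z : nat -> R) : (1 < n)%N ->
  wt_form n z = 0 <-> forall i, (0 < i < n.-1)%N -> z i = 0.
Proof.
case: n => [|[|k]] // _; rewrite wt_formE /=; split=> [/eqP|z0]; last first.
  apply: big1 => i _; rewrite big1 ?expr0n ?mulr0 // => -[[|j] jlt] _ /=.
    by rewrite wt0 mul0r.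
  by rewrite z0 ?mulr0 //; have := ltn_ord i; lia.
rewrite psumr_eq0 => [/allP F0|i _]; last first.
  by rewrite mulr_ge0 ?sqr_ge0 // ltW ?wt_form_coef_gt0.
have part i : (i < k)%N -> \sum_(j < i.+2) wt R j * z j = 0.
  move=> ik; have := F0 (Ordinal ik) (mem_index_enum _); rewrite mulf_eq0 sqrf_eq0.
  by rewrite gt_eqF ?wt_form_coef_gt0 //= => /eqP.
case=> [|i] //; rewrite ltnS => ik; have := part i ik; rewrite big_ord_recr /=.
have -> : \sum_(j < i.+1) wt R j * z j = 0.
  by case: i ik => [|i] ik; [rewrite big_ord1 wt0 mul0r | apply: part; lia].
by rewrite add0r => /eqP; rewrite mulf_eq0 gt_eqF ?wt_gt0 //= => /eqP.
Qed.

End QuadraticForm.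

(** * Edges of a subdivided ladder *)

Section Arcs.
Variables (n : nat) (t : nat -> 'I_5).
Local Notation V := (chain_vertex n).
Local Notation tops := (fun j : 'I_n => t j).

(* [inl i] is the rung i, directed downwards; [inr (j, k)] is the k-th of the six
   other edges of square j, first the top ones and then the bottom ones, directed
   to the right. *)
Definition edge : finType := ('I_n.+1 + 'I_n * 'I_6)%type.

(** Positions along a path start with 0 at the left rung; every position past the new vertices
    denotes the right rung. *)
Definition top_point (j : 'I_n) (p : nat) : V :=
  if p is q.+1 then
    if (q < t j)%N then new_vertex j (inord q) else top_vertex (right_end j)
  else top_vertex (left_end j).
Definition bot_point (j : 'I_n) (p : nat) : V :=
  if p is q.+1 then
    if (t j + q < 4)%N then new_vertex j (inord (t j + q)) else bot_vertex (right_end j)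
  else bot_vertex (left_end j).

Definition src (e : edge) : V :=
  match e with
  | inl i => top_vertex i
  | inr (j, k) => if (k <= t j)%N then top_point j k else bot_point j (k - (t j).+1)
  end.
Definition tgt (e : edge) : V :=
  match e with
  | inl i => bot_vertex i
  | inr (j, k) => if (k <= t j)%N then top_point j k.+1 else bot_point j (k - (t j).+1).+1
  end.

Lemma consecutive_map (f : nat -> V) a m x y :
  reflect (exists2 p, (a <= p < a + m)%N & x = f p /\ y = f p.+1)
          (consecutive [seq f p | p <- iota a m.+1] x y).
Proof.
rewrite /consecutive.
have -> : zip [seq f p | p <- iota a m.+1] (behead [seq f p | p <- iota a m.+1])
   = [seq (f p, f p.+1) | p <- iota a m].
  by elim: m a => //= m IHm a; rewrite -IHm.
apply: (iffP mapP) => [[p]|[p pm [-> ->]]].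
  by rewrite mem_iota => pm [-> ->]; exists p.
by exists p => //; rewrite mem_iota.
Qed.

Lemma filter_enum4 (P : pred nat) :
  [seq k : 'I_4 <- enum 'I_4 | P k] = [seq inord p | p <- iota 0 4 & P p].
Proof.
apply: (inj_map val_inj); rewrite -map_comp.
rewrite -[map val _](filter_map val P) val_enum_ord.
rewrite -[LHS]map_id; apply/eq_in_map => p; rewrite mem_filter mem_iota => /andP[_ p4].
by rewrite /= inordK.
Qed.

Lemma top_pathE (j : 'I_n) :
  top_path tops j = [seq top_point j p | p <- iota 0 (t j).+2].
Proof.
rewrite /top_path (filter_enum4 (fun p => p < t j)%N) -map_comp /top_point.
by case: (t j) => [[|[|[|[|[|m]]]]] lt5].
Qed.

Lemma bot_pathE (j : 'I_n) :
  bot_path tops j = [seq bot_point j p | p <- iota 0 (6 - t j)].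
Proof.
rewrite /bot_path (filter_enum4 (fun p => t j <= p)%N) -map_comp /bot_point.
by case: (t j) => [[|[|[|[|[|m]]]]] lt5].
Qed.

Lemma chain_arcP x y :
  reflect (exists2 e, src e = x & tgt e = y) (chain_arc tops x y).
Proof.
apply: (iffP orP) => [[/existsP[i /andP[/eqP-> /eqP->]]|/existsP[j]]|[[i|[j k]] <- <-]].
- by exists (inl i).
- rewrite top_pathE bot_pathE.
  have -> : (6 - t j = (5 - t j).+1)%N by have := ltn_ord (t j); lia.
  case/orP => /consecutive_map[p /andP[_ pt] [-> ->]].
    have p6 : (p < 6)%N by have := ltn_ord (t j); lia.
    exists (inr (j, Ordinal p6)) => /=; case: ifP => //; lia.
  have p6 : (p + (t j).+1 < 6)%N by have := ltn_ord (t j); lia.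
  exists (inr (j, Ordinal p6)) => /=; rewrite addnK; case: ifP => //; lia.
- by left; apply/existsP; exists i; rewrite !eqxx.
right; apply/existsP; exists j; rewrite top_pathE bot_pathE.
have -> : (6 - t j = (5 - t j).+1)%N by have := ltn_ord (t j); lia.
have k6 := ltn_ord k; have t5 := ltn_ord (t j).
apply/orP; have [kt|tk] := leqP k (t j); [left|right]; apply/consecutive_map.
  by exists (k : nat); rewrite /= ?kt //; lia.
by exists (k - (t j).+1)%N; rewrite /= ?(leqNgt k) ?tk //; lia.
Qed.

(** A ladder vertex is assigned to the square on its right, at position 0. The last rung thus gets
    the index [n], one past the last square. *)
Definition square_of (x : V) : nat :=
  match x with inl (inl i) => i | inl (inr i) => i | inr (j, _) => j end.
Definition side (x : V) : bool :=
  match x with inl (inl _) => true | inl (inr _) => false | inr (j, k) => (k < t j)%N end.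
Definition pos (x : V) : nat :=
  if x is inr (j, k) then (if (k < t j)%N then k.+1 else k.+1 - t j)%N else 0%N.

Definition arc_pos (j k : nat) : nat := (if (k <= t j)%N then k else k - (t j).+1)%N.

Lemma src_path (j : 'I_n) (k : 'I_6) (x := src (inr (j, k))) :
  [/\ square_of x = j, side x = (k <= t j)%N & pos x = arc_pos j k].
Proof.
rewrite {}/x /= /arc_pos; have k6 := ltn_ord k; have t5 := ltn_ord (t j).
have [kt|tk] := leqP k (t j).
  case: (k : nat) kt => [|p] pt; first by split.
  rewrite /top_point pt; split=> //=; rewrite inordK ?pt //; lia.
case E : (k - (t j).+1)%N => [|q]; first by split.
have q4 : (t j + q < 4)%N by lia.
rewrite /bot_point q4; split=> //=; rewrite inordK //.
  by rewrite ltnNge leq_addr.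
by rewrite ltnNge leq_addr /= -addnS addKn.
Qed.

Definition last_arc (j k : nat) : bool := (k == t j) || (k == 5).

Lemma tgt_path (j : 'I_n) (k : 'I_6) (x := tgt (inr (j, k))) :
  [/\ square_of x = if last_arc j k then j.+1 else j, side x = (k <= t j)%N &
      pos x = if last_arc j k then 0%N else (arc_pos j k).+1].
Proof.
rewrite {}/x /= /arc_pos /last_arc; have k6 := ltn_ord k; have t5 := ltn_ord (t j).
have [kt|tk] := leqP k (t j).
  have -> : (k == 5 :> nat) = false by apply/eqP; lia.
  rewrite orbF /top_point; case: ltngtP kt => // kt _; split=> //=; rewrite inordK ?kt //; lia.
rewrite (gtn_eqF tk) /= /bot_point; have -> : (t j + (k - (t j).+1) = k.-1)%N by lia.
have [k4|k5] := ltnP k.-1 4.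
  have -> : (k == 5 :> nat) = false by apply/eqP; lia.
  have kt : (k.-1 < t j)%N = false by lia.
  split=> //=; rewrite inordK // kt //; lia.
have -> : (k == 5 :> nat) by apply/eqP; lia.
by split.
Qed.

Lemma path_arc_inj (j j' : 'I_n) (k k' : 'I_6) :
  src (inr (j, k)) = src (inr (j', k')) -> (j, k) = (j', k').
Proof.
move=> eq_src; have [s1 s2 s3] := src_path j k; have [] := src_path j' k'.
rewrite -eq_src s1 s2 s3 => jj; have {}jj : j = j' by apply: val_inj.
move: s1 s2 s3; rewrite -{}jj /arc_pos => _ _ _ kk pp; congr (_, _).
apply: val_inj => /=; move: pp; rewrite -kk; case: leqP kk => //=; lia.
Qed.

Lemma arc_inj e e' : src e = src e' -> tgt e = tgt e' -> e = e'.
Proof.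
case: e e' => [i|[j k]] [i'|[j' k']].
- by move=> [->].
- move=> es et; have [_ s _] := src_path j' k'; have [_ s' _] := tgt_path j' k'.
  by move: s s'; rewrite -es -et => /= <-.
- move=> es et; have [_ s _] := src_path j k; have [_ s' _] := tgt_path j k.
  by move: s s'; rewrite es et => /= <-.
by move=> /path_arc_inj->.
Qed.

(** A function that increases along every arc, so that no two arcs are opposite. Positions are at
    most 4, so 12 per square outweighs the reset of [pos] at the next rung. *)
Definition height (x : V) : nat := (12 * square_of x + 2 * pos x + ~~ side x)%N.

Lemma arc_height e : (height (src e) < height (tgt e))%N.
Proof.
case: e => [i|[j k]]; first by rewrite /height /=; lia.
rewrite /height; have [-> -> ->] := src_path j k; have [-> -> ->] := tgt_path j k.
rewrite ltn_add2r /last_arc /arc_pos.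
have := ltn_ord k; have := ltn_ord (t j); case: ifP; case: ifP; lia.
Qed.

Lemma chain_adjE (R : numDomainType) (x y : subdivided_ladder tops) :
  (adj x y)%:R = \sum_e ((src e == x) && (tgt e == y))%:R +
                 \sum_e ((src e == y) && (tgt e == x))%:R :> R.
Proof.
have arcE u v : \sum_e ((src e == u) && (tgt e == v))%:R = (chain_arc tops u v)%:R :> R.
  case: chain_arcP => [[e <- <-]|noarc].
    rewrite (bigD1 e) //= !eqxx big1 ?addr0 // => e' ee'.
    by case: eqP => //= es; case: eqP => //= et; rewrite (arc_inj es et) eqxx in ee'.
  by rewrite big1 // => e _; case: eqP => //= es; case: eqP => //= et; case: noarc; exists e.
rewrite !arcE /adj /= /chain_adj; case: chain_arcP => [[e <- <-]|_]; last by rewrite add0r.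
case: chain_arcP => [[e' es et]|_]; last by rewrite addr0.
have := arc_height e; have := arc_height e'; rewrite es et; lia.
Qed.

End Arcs.

(** * Flows and loops in a subdivided ladder *)

Section Flow.
Variables (R : realFieldType) (n : nat) (t : nat -> 'I_5).
Local Notation V := (chain_vertex n).
Local Notation tops := (fun j : 'I_n => t j).
Local Notation edge := (edge n).
Local Notation src := (@src n t).
Local Notation tgt := (@tgt n t).
Local Notation side := (@side n t).
Local Notation pos := (@pos n t).
Local Notation green := (@green R n).

Lemma sum_arc (F : edge -> R) :
  \sum_e F e = \sum_i F (inl i) + \sum_j \sum_k F (inr (j, k)).
Proof. by rewrite big_sumType pair_bigA; congr (_ + _); apply: eq_bigr => -[]. Qed.

Lemma sum_vertex (F : V -> R) : \sum_x F x = \sum_i (F (top_vertex i) + F (bot_vertex i)) +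
  \sum_j \sum_k F (new_vertex j k).
Proof.
by rewrite 2!big_sumType pair_bigA big_split; congr (_ + _); apply: eq_bigr => -[].
Qed.

Lemma sum_pick m (F : nat -> R) j : \sum_(i < m) (i == j :> nat)%:R * F i = (j < m)%:R * F j.
Proof.
have [jm|mj] := ltnP j m.
  rewrite (bigD1 (Ordinal jm)) //= eqxx big1 ?addr0 // => i.
  by rewrite -val_eqE /= => /negPf->; rewrite mul0r.
rewrite big1 ?mul0r // => i _; rewrite ltn_eqF ?mul0r //.
exact: leq_trans (ltn_ord i) mj.
Qed.

Lemma sum_square m (A B : nat -> R) : (m < 5)%N ->
  \sum_(k < 6) (if (k <= m)%N then A k else B (k - m.+1)%N) =
  \sum_(p < m.+1) A p + \sum_(p < 5 - m) B p.
Proof.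
case: m => [|[|[|[|[|m]]]]] // _;
by rewrite !big_ord_recl !big_ord0 /= /bump /= ?subnE /=; ring.
Qed.

Definition sg (b : bool) : R := if b then 1 else -1.

(* [3 + excess j] top and [3 - excess j] bottom edges in square j. *)
Definition excess (j : nat) : R := (t j)%:R - 2.

(** The boundary of square [l], traversed clockwise. *)
Definition loop (l : nat) (e : edge) : R :=
  match e with
  | inl i => (i == l.+1 :> nat)%:R - (i == l :> nat)%:R
  | inr (j, k) => (j == l :> nat)%:R * sg (k <= t j)%N
  end.

(* A unit current enters half and half at the two ends of the leftmost rung, runs
   in parallel through the squares before x, joins on the side of x through one
   rung, and reaches x along that side. *)
Definition flow (x : V) (e : edge) : R :=
  match e with
  | inl i => - (sg (side x) / 2 * (i == square_of x :> nat)%:R)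
  | inr (j, k) => (j < square_of x)%:R / 2 + (j == square_of x :> nat)%:R *
      ((side x == (k <= t j))%N && (arc_pos t j k < pos x)%N)%:R
  end.

(** The inner product of [flow x] and [loop l], see [flow_loop]. Half currents on both sides of an
    earlier square give its excess; the joining rung gives halves of opposite signs to the two
    squares it separates. *)
Definition overlap (x : V) (l : nat) : R := (l < square_of x)%:R * excess l +
  sg (side x) * ((pos x)%:R + 1 / 2) * (l == square_of x)%:R
  - sg (side x) / 2 * (l.+1 == square_of x)%:R.

Lemma sum_pick_ord m (F : 'I_m -> R) (j : 'I_m) :
  \sum_(i < m) (i == j :> nat)%:R * F i = F j.
Proof.
rewrite (bigD1 j) //= eqxx mul1r big1 ?addr0 // => i.
by rewrite -val_eqE => /negPf->; rewrite mul0r.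
Qed.

Lemma telescope_ord m (F : nat -> R) : \sum_(i < m) (F i.+1 - F i) = F m - F 0.
Proof.
elim: m => [|m IHm]; first by rewrite big_ord0 subrr.
by rewrite big_ord_recr IHm /=; ring.
Qed.

Lemma loop_cycle (psi : V -> R) (l : 'I_n) :
  \sum_e loop l e * (psi (tgt e) - psi (src e)) = 0.
Proof.
rewrite sum_arc /=.
under eq_bigr do rewrite mulrBl.
rewrite sumrB (@sum_pick_ord _ _ (right_end l)) (@sum_pick_ord _ _ (left_end l)).
under eq_bigr do under eq_bigr do rewrite -mulrA.
under eq_bigr do rewrite -mulr_sumr.
rewrite sum_pick_ord.
rewrite (eq_bigr (fun k : 'I_6 => if (k <= t l)%N
    then psi (top_point t l k.+1) - psi (top_point t l k)
    else psi (bot_point t l (k - (t l).+1)) - psi (bot_point t l (k - (t l).+1).+1))).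
  rewrite (sum_square (fun k => psi (top_point t l k.+1) - psi (top_point t l k))
    (fun k => psi (bot_point t l k) - psi (bot_point t l k.+1))) //.
  rewrite (telescope_ord _ (fun k => psi (top_point t l k))).
  under [X in _ + (_ + X)]eq_bigr do rewrite -opprB.
  rewrite sumrN (telescope_ord _ (fun k => psi (bot_point t l k))) /= ltnn.
  have t5 := ltn_ord (t l); have -> : (5 - t l = (4 - t l).+1)%N by lia.
  by rewrite /= subnKC // ltnn; ring.
by move=> k _ /=; rewrite /sg; case: ifP => _; ring.
Qed.

(** A loop has two rungs and six other edges; neighbouring loops traverse their common rung in
    opposite directions. *)
Lemma loop_gram (l l' : 'I_n) : \sum_e loop l e * loop l' e =
  8 * (l == l')%:R - (l.+1 == l')%:R - (l'.+1 == l)%:R.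
Proof.
rewrite sum_arc /=.
under eq_bigr do rewrite mulrBl.
rewrite sumrB (@sum_pick_ord _ _ (right_end l)) (@sum_pick_ord _ _ (left_end l)) /=.
under eq_bigr do under eq_bigr do rewrite -mulrA.
under eq_bigr do rewrite -mulr_sumr.
rewrite sum_pick_ord.
under eq_bigr do rewrite mulrCA.
rewrite -mulr_sumr (eq_bigr (fun=> 1)); last by move=> k _; rewrite /sg; case: ifP => _; ring.
rewrite sumr_const card_ord eqSS -(inj_eq val_inj) /= (eq_sym (l : nat) l'.+1); ring.
Qed.

Lemma sum_sg j : \sum_(k < 6) sg (k <= t j)%N = 2 * excess j.
Proof.
rewrite /sg /excess; case: (t j) => [[|[|[|[|[|m]]]]] //= _];
  by rewrite !big_ord_recl big_ord0 /=; ring.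
Qed.

Lemma sum_side x (j : 'I_n) (F : bool -> R) : square_of x = j ->
  \sum_(k < 6) ((side x == (k <= t j))%N && (arc_pos t j k < pos x)%N)%:R * F (k <= t j)%N =
  F (side x) * (pos x)%:R.
Proof.
move=> Ej; rewrite (eq_bigr (fun k : 'I_6 => F (side x) *
    ((side x == (k <= t j))%N && (arc_pos t j k < pos x)%N)%:R)); last first.
  by move=> k _; rewrite mulrC; case: eqP => [->|_] //; rewrite !mulr0.
rewrite -mulr_sumr; congr (_ * _).
case: x Ej => [[i|i]|[j' k]] /= Ej;
  try by apply: big1 => k _; rewrite ltn0 andbF.
rewrite Ej /arc_pos; case: (t j) => [[|[|[|[|[|m]]]]] //= _];
  case: k => [[|[|[|[|m]]]] //= _]; rewrite !big_ord_recl big_ord0 /=;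
  rewrite ?subSS ?subn0; ring.
Qed.

Lemma square_of_le (x : V) : (square_of x <= n)%N.
Proof. by case: x => [[i|i]|[j k]] /=; rewrite -ltnS //; apply: ltnW; rewrite ltnS. Qed.

Lemma flow_loop x (l : 'I_n) : \sum_e flow x e * loop l e = overlap x l.
Proof.
rewrite sum_arc /=.
under eq_bigr do rewrite mulrC mulrBl.
rewrite sumrB (@sum_pick_ord _ _ (right_end l)) (@sum_pick_ord _ _ (left_end l)) /=.
under eq_bigr do under eq_bigr do rewrite mulrCA.
under eq_bigr do rewrite -mulr_sumr.
rewrite sum_pick_ord.
under eq_bigr do rewrite mulrDl -!mulrA.
rewrite big_split /= -!mulr_sumr sum_sg /overlap.
have -> : (l == square_of x :> nat)%:R * \sum_(k < 6)
    ((side x == (k <= t l))%N && (arc_pos t l k < pos x)%N)%:R * sg (k <= t l)%N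
  = (l == square_of x :> nat)%:R * (sg (side x) * (pos x)%:R).
  by case: eqP => [lx|_]; [rewrite sum_side | rewrite !mul0r].
by rewrite /bump /= add1n; field.
Qed.

Lemma arc_pos_eq j (k k' : 'I_6) : (k == k') =
  ((k <= t j)%N == (k' <= t j)%N) && (arc_pos t j k == arc_pos t j k').
Proof.
rewrite /arc_pos -(inj_eq val_inj) /=; apply/eqP/andP => [->|[/eqP kk]]; first by rewrite !eqxx.
by move: kk; case: (leqP k); case: (leqP k') => // ? ? _ /eqP //; lia.
Qed.

(** Following [flow (src e)] by [e] gives another unit flow to [tgt e], so the two differ by loops.
    A loop is needed only if [e] ends at the next rung, since the flow to a rung runs in parallel
    through the square before it. *)
Lemma flow_arc e : exists z : 'I_n -> R, forall e',
  flow (tgt e) e' - flow (src e) e' = (e == e')%:R + \sum_l z l * loop l e'.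
Proof.
case: e => [i|[j k]].
  exists (fun=> 0) => -[i'|[j' k']]; rewrite big1 ?addr0 => [|l _]; rewrite ?mul0r //=.
    by rewrite -[inl i == inl i']/(i == i') eq_sym -(inj_eq val_inj) /=; field.
  by rewrite !ltn0 !andbF; ring.
have [s1 s2 s3] := src_path t j k; have [t1 t2 t3] := tgt_path t j k.
move: t1 t3; case: (boolP (last_arc t j k)) => [lastk|nlastk] t1 t3; last first.
  exists (fun=> 0) => -[i'|[j' k']]; rewrite big1 ?addr0 => [|l _]; rewrite ?mul0r //;
    rewrite /flow s1 s2 ?s3 t1 t2 ?t3; first by rewrite subrr.
  rewrite opprD addrACA subrr add0r -mulrBr.
  have -> : (inr (j, k) == inr (j', k') :> edge) = (j == j') && (k == k') by [].
  rewrite (arc_pos_eq j) (inj_eq val_inj) (eq_sym j').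
  case: (eqVneq j j') => [<-|_]; last by rewrite mul0r.
  rewrite mul1r ltnS; case: eqP => _ /=; last by rewrite subrr.
  by case: ltngtP; rewrite ?subrr ?subr0.
(* This multiple of [loop j] moves half of the current from the side of the arc to the opposite side
   of square [j]. *)
exists (fun l : 'I_n => (l == j :> nat)%:R * (- sg (k <= t j)%N / 2)) => e'.
have -> : \sum_(l < n) (l == j :> nat)%:R * (- sg (k <= t j)%N / 2) * loop l e'
  = - sg (k <= t j)%N / 2 * loop j e'.
  by under eq_bigr do rewrite -mulrA; rewrite sum_pick_ord.
case: e' => [i'|[j' k']] /=.
  by rewrite s1 s2 t1 t2; field.
have -> : (inr (j, k) == inr (j', k') :> edge) = (j == j') && (k == k') by [].
rewrite (arc_pos_eq j) s1 s2 s3 t1 t2 t3 ltn0 andbF mulr0 addr0 ltnS.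
rewrite (inj_eq val_inj) (eq_sym j') leq_eqVlt.
case: (eqVneq j j') => [<-|jj']; last first.
  have -> : (j' == j :> nat) = false by rewrite eq_sym -(inj_eq val_inj) in jj'; apply/negbTE.
  by rewrite /=; field.
rewrite eqxx ltnn.
have : (arc_pos t j k' <= arc_pos t j k)%N || ((k <= t j)%N != (k' <= t j)%N).
  move: lastk; rewrite /last_arc /arc_pos; have := ltn_ord k'.
  case: (leqP k (t j)); case: (leqP k' (t j)) => /=; lia.
rewrite /sg; case: (leqP k) => kt; case: (leqP k') => kt' /=; rewrite ?orbT ?orbF;
  first [by move=> _; field | by case: ltngtP => //= _ _; field].
Qed.

(** The zero boundary values of [F] stand for the square missing to the left of the first rung or to
    the right of the last one. *)
Lemma overlap_pair x (F : nat -> R) : F 0 = 0 -> F n.+1 = 0 ->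
  \sum_(l < n) overlap x l * F l.+1 =
  \sum_(l < n) (l < square_of x)%:R * excess l * F l.+1 +
  sg (side x) * ((pos x)%:R + 1 / 2) * F (square_of x).+1 - sg (side x) / 2 * F (square_of x).
Proof.
move=> F0 Fn; have sn := square_of_le x; under eq_bigr do rewrite /overlap mulrBl mulrDl.
rewrite sumrB big_split /=; congr (_ + _ - _).
  under eq_bigr do rewrite -!mulrA.
  rewrite -!mulr_sumr (sum_pick n (fun l => F l.+1)) mulrA; congr (_ * _).
  by case: ltngtP sn => // [_|->]; rewrite ?mul1r ?mul0r.
under eq_bigr do rewrite -!mulrA.
rewrite -!mulr_sumr mulrA; congr (_ * _).
case: (square_of x) sn => [|J] Jn; first by rewrite big1 ?F0 // => l _; rewrite mul0r.
by rewrite (sum_pick n (fun l => F l.+1)) Jn mul1r.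
Qed.

(** * Projection of the flows off the loops *)

Definition green_overlap (x : V) (a : nat) : R :=
  \sum_(l < n) overlap x l * green a l.+1.

Lemma green_overlap0 x : green_overlap x 0 = 0.
Proof. by apply: big1 => l _; rewrite green0 mulr0. Qed.

Lemma green_overlapS x : green_overlap x n.+1 = 0.
Proof.
by apply: big1 => l _; rewrite greenS ?mulr0 // ltnS ltnW.
Qed.

Lemma green_overlap_rec x (l : 'I_n) :
  8 * green_overlap x l.+1 - green_overlap x l - green_overlap x l.+2 = overlap x l.
Proof.
rewrite /green_overlap mulr_sumr -!sumrB.
rewrite (eq_bigr (fun l' : 'I_n => (l' == l :> nat)%:R * overlap x l')).
  by rewrite sum_pick_ord.
by move=> l' _; rewrite -(eq_sym (l : nat)) -(green_inv R (ltn_ord l) (ltn_ord l')); ring.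
Qed.

(** The projection of [flow x] orthogonal to all loops, that is, the electrical flow to [x]. *)
Definition harmonic_flow (x : V) (e : edge) : R :=
  flow x e - \sum_(l < n) green_overlap x l.+1 * loop l e.

Lemma loop_harmonic x (l : 'I_n) : \sum_e loop l e * harmonic_flow x e = 0.
Proof.
rewrite /harmonic_flow; under eq_bigr do rewrite mulrBr mulr_sumr.
rewrite sumrB; under eq_bigr do rewrite mulrC; rewrite flow_loop exchange_big /=.
under eq_bigr do under eq_bigr do rewrite mulrCA.
under eq_bigr do rewrite -mulr_sumr loop_gram.
rewrite -green_overlap_rec.
rewrite (eq_bigr (fun l' : 'I_n => 8 * ((l' == l :> nat)%:R * green_overlap x l'.+1)
   - (l' == l.+1 :> nat)%:R * green_overlap x l'.+1
   - (l'.+1 == l)%:R * green_overlap x l'.+1)); last first.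
  by move=> l' _; rewrite -(inj_eq val_inj) /= (eq_sym (l : nat)) (eq_sym l.+1); ring.
rewrite !sumrB -mulr_sumr !(sum_pick n (fun a => green_overlap x a.+1)) ltn_ord mul1r.
(* At either end of the chain the missing neighbour in the recurrence is a zero boundary value of
   [green_overlap]. *)
have -> : (l.+1 < n)%:R * green_overlap x l.+2 = green_overlap x l.+2.
  have := ltn_ord l; rewrite leq_eqVlt => /orP[/eqP->|->]; last by rewrite mul1r.
  by rewrite green_overlapS mulr0.
have -> : \sum_(i < n) (i.+1 == l)%:R * green_overlap x i.+1 = green_overlap x l.
  case: l => -[|l] ln /=; first by rewrite big1 ?green_overlap0 // => i _; rewrite mul0r.
  by rewrite (sum_pick n (fun a => green_overlap x a.+1)) ltnW // mul1r.
ring.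
Qed.

(** Loops pair to zero with gradients, so of the difference given by [flow_arc] only the arc [e]
    survives. This is [g_arc] for the kernel. *)
Lemma harmonic_flow_arc e (psi : V -> R) :
  \sum_e' (harmonic_flow (tgt e) e' - harmonic_flow (src e) e') * (psi (tgt e') - psi (src e'))
  = psi (tgt e) - psi (src e).
Proof.
have [z flowE] := flow_arc e.
pose c l := z l - (green_overlap (tgt e) l.+1 - green_overlap (src e) l.+1).
rewrite (eq_bigr (fun e' => (e == e')%:R * (psi (tgt e') - psi (src e')) +
   \sum_l c l * (loop l e' * (psi (tgt e') - psi (src e'))))); last first.
  move=> e' _; under [X in _ = _ + X]eq_bigr do rewrite mulrA.
  rewrite -mulr_suml -mulrDl; congr (_ * _).
  rewrite (eq_bigr (fun l : 'I_n => z l * loop l e' -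
    (green_overlap (tgt e) l.+1 * loop l e' - green_overlap (src e) l.+1 * loop l e'))).
    by rewrite !sumrB; have := flowE e'; rewrite /harmonic_flow; lra.
  by move=> l _; rewrite /c; ring.
rewrite big_split exchange_big /=.
rewrite (bigD1 e) //= eqxx mul1r big1 => [|e' ee']; last by rewrite eq_sym (negPf ee') mul0r.
rewrite addr0 big1 ?addr0 // => l _.
by rewrite -mulr_sumr loop_cycle mulr0.
Qed.

(** The same with loops orthogonal to [harmonic_flow x]. This is [fg_arc] for the kernel. *)
Lemma flow_harmonic_arc x e :
  \sum_e' (flow (tgt e) e' - flow (src e) e') * harmonic_flow x e' = harmonic_flow x e.
Proof.
have [z flowE] := flow_arc e.
under eq_bigr do rewrite flowE mulrDl mulr_suml.
rewrite big_split exchange_big /=.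
rewrite (bigD1 e) //= eqxx mul1r big1 => [|e' ee']; last by rewrite eq_sym (negPf ee') mul0r.
rewrite addr0 big1 ?addr0 // => l _.
under eq_bigr do rewrite -mulrA.
by rewrite -mulr_sumr loop_harmonic mulr0.
Qed.

Definition total_flow (e : edge) : R := \sum_x flow x e.
Definition total_overlap (l : nat) : R := \sum_x overlap x l.

Lemma card_chain_vertex : #|{: V}| = (6 * n + 2)%N.
Proof. by rewrite card_sum card_sum card_prod !card_ord; lia. Qed.

Lemma kirchhoff_index_flow : kirchhoff_index R (subdivided_ladder tops) =
  (6 * n + 2)%:R * (\sum_x \sum_e flow x e ^+ 2
                   - \sum_x \sum_(l < n) overlap x l * green_overlap x l.+1)
  - (\sum_e total_flow e ^+ 2
     - \sum_(l < n) \sum_(l' < n) total_overlap l * (total_overlap l' * green l.+1 l'.+1)).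
Proof.
rewrite (kernel_kirchhoff_index (@chain_adjE n t R) harmonic_flow_arc flow_harmonic_arc);
  last exact: subdivided_ladder_connected.
rewrite card_chain_vertex; congr (_ * _ - _).
  rewrite -sumrB; apply: eq_bigr => x _; rewrite /harmonic_flow.
  under eq_bigr do rewrite mulrBr mulr_sumr -expr2.
  rewrite sumrB exchange_big /=; congr (_ - _); apply: eq_bigr => l _.
  by under eq_bigr do rewrite mulrCA; rewrite -mulr_sumr flow_loop mulrC.
have totE e : \sum_x harmonic_flow x e = total_flow e -
    \sum_(l < n) (\sum_(l' < n) total_overlap l' * green l.+1 l'.+1) * loop l e.
  rewrite sumrB exchange_big; congr (_ - _); apply: eq_bigr => l _ /=.
  rewrite -mulr_suml; congr (_ * _); rewrite /green_overlap exchange_big /=.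
  by apply: eq_bigr => l' _; rewrite -mulr_suml.
have totL (l : 'I_n) : \sum_e total_flow e * loop l e = total_overlap l.
  rewrite /total_flow; under eq_bigr do rewrite mulr_suml.
  by rewrite exchange_big; apply: eq_bigr => x _; rewrite flow_loop.
under eq_bigr do rewrite totE -/(total_flow _) mulrBr -expr2 mulr_sumr.
rewrite sumrB exchange_big /=; congr (_ - _); apply: eq_bigr => l _.
by under eq_bigr do rewrite mulrCA; rewrite -mulr_sumr totL mulrC mulr_sumr.
Qed.

(** * Summation over the vertices *)

Lemma sum_gt m j : \sum_(i < m) (j < i)%:R = (m - j.+1)%:R :> R.
Proof.
elim: m => [|m IHm]; first by rewrite big_ord0.
rewrite big_ord_recr IHm /= subSS; by case: ltnP => jm; rewrite ?addr0 -?natrD; congr (_%:R); lia.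
Qed.

Lemma sum_lt m j : (j <= m)%N -> \sum_(i < m) (i < j)%:R = j%:R :> R.
Proof.
move=> jm; rewrite -(subnKC jm) big_split_ord /= [X in _ + X]big1 ?addr0.
  by under eq_bigr do rewrite ltn_ord; rewrite sumr_const card_ord.
by move=> i _; rewrite ltnNge leq_addr.
Qed.

(** This and the next three sums are checked for each of the five values of [t j]. Exchanging top
    and bottom negates the excess, so unsigned sums are even in it and signed sums odd. *)
Lemma sum_new_pos (j : 'I_n) :
  \sum_k (pos (new_vertex j k))%:R = 6 + excess j ^+ 2 :> R.
Proof.
rewrite /excess /=; case: (t j) => [[|[|[|[|[|m]]]]] //= _];
  rewrite !big_ord_recl big_ord0 /=; rewrite /bump /= ?subSS ?subn0; ring.
Qed.

Lemma sum_new_pos2 (j : 'I_n) :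
  \sum_k ((pos (new_vertex j k))%:R + 1 / 2) ^+ 2 = 17 + 6 * excess j ^+ 2 :> R.
Proof.
rewrite /excess /=; case: (t j) => [[|[|[|[|[|m]]]]] //= _];
  by rewrite !big_ord_recl big_ord0 /=; rewrite /bump /= ?subSS ?subn0; field.
Qed.

Lemma sum_new_sg (j : 'I_n) :
  \sum_k sg (side (new_vertex j k)) = 2 * excess j.
Proof.
rewrite /excess /=; case: (t j) => [[|[|[|[|[|m]]]]] //= _];
  by rewrite !big_ord_recl big_ord0 /= /sg /=; ring.
Qed.

Lemma sum_new_sg_pos (j : 'I_n) :
  \sum_k sg (side (new_vertex j k)) * ((pos (new_vertex j k))%:R + 1 / 2) = 6 * excess j.
Proof.
rewrite /excess /=; case: (t j) => [[|[|[|[|[|m]]]]] //= _];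
  by rewrite !big_ord_recl big_ord0 /= /sg /=; rewrite /bump /= ?subSS ?subn0; field.
Qed.

Lemma sum_new_beyond (j : 'I_n) (k : 'I_6) :
  \sum_k' ((side (new_vertex j k') == (k <= t j)%N) &&
            (arc_pos t j k < pos (new_vertex j k'))%N)%:R
  = (if k <= t j then t j - k else 5 - k)%N%:R :> R.
Proof.
rewrite /arc_pos /=; case: (t j) => [[|[|[|[|[|m]]]]] //= _];
  case: k => [[|[|[|[|[|[|k]]]]]] //= _];
  by rewrite !big_ord_recl big_ord0 /=; rewrite /bump /= ?subSS ?subn0; ring.
Qed.

(** The joining rung costs 1/4, each earlier square six times 1/4, and each arc from the rung to [x]
    costs 1. *)
Lemma flow_energy x :
  \sum_e flow x e ^+ 2 = 1 / 4 + 3 / 2 * (square_of x)%:R + (pos x)%:R.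
Proof.
rewrite sum_arc /= -addrA; congr (_ + _).
  rewrite (eq_bigr (fun i : 'I_n.+1 => (i == square_of x :> nat)%:R * (1 / 4))).
    by rewrite (sum_pick n.+1 (fun=> 1 / 4)) ltnS square_of_le /=; field.
  by move=> i _; rewrite /sg; case: (_ == _); case: (side x) => /=; field.
rewrite (eq_bigr (fun j : 'I_n => 3 / 2 * (j < square_of x)%:R +
    (j == square_of x :> nat)%:R * (pos x)%:R)).
  rewrite big_split /= -mulr_sumr sum_lt ?square_of_le // (sum_pick n (fun=> (pos x)%:R)).
  congr (_ + _); have := square_of_le x; rewrite leq_eqVlt => /orP[|->]; last by rewrite /= mul1r.
  by case: x => [[i|i]|[j k]] /=; rewrite ?mulr0 // ltn_ord /= mul1r.
move=> j _; case: ltngtP => [jx|jx|jx].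
- by under eq_bigr do rewrite /= mul0r addr0; rewrite sumr_const card_ord /=; field.
- by rewrite big1 => [|k _] /=; ring.
rewrite /= mulr0 add0r mul1r -[RHS]mul1r -(@sum_side x j (fun=> 1) (esym jx)).
apply: eq_bigr => k _; by case: (_ && _) => /=; field.
Qed.

Lemma sum_flow_energy : \sum_x \sum_e flow x e ^+ 2 =
  \sum_(i < n.+1) (1 / 2 + 3 * i%:R) + \sum_(j < n) (7 + 6 * j%:R) + \sum_(j < n) excess j ^+ 2.
Proof.
under eq_bigr do rewrite flow_energy.
rewrite sum_vertex -addrA -big_split /=; congr (_ + _); apply: eq_bigr => j _.
  by field.
by rewrite big_split sum_new_pos sumr_const card_ord /=; field.
Qed.

Lemma total_flow_rung (i : 'I_n.+1) :
  total_flow (inl i) = - ((i < n)%:R * excess i).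
Proof.
rewrite /total_flow sum_vertex big1 ?add0r /= => [|i' _]; last by ring.
rewrite (eq_bigr (fun j : 'I_n => (j == i :> nat)%:R * - excess j)).
  by rewrite (sum_pick n (fun j => - excess j)) mulrN.
move=> j _; rewrite sumrN mulrN -mulr_suml -mulr_suml sum_new_sg eq_sym.
by congr (- _); field.
Qed.

Lemma total_flow_path (j : 'I_n) (k : 'I_6) : total_flow (inr (j, k)) =
  3 * (n - j.+1)%:R + 1 + (if k <= t j then t j - k else 5 - k)%N%:R.
Proof.
rewrite /total_flow sum_vertex /=.
rewrite (eq_bigr (fun i : 'I_n.+1 => (j < i)%:R)) => [|i _]; last first.
  by rewrite ltn0 !andbF; case: (j < i)%N => /=; field.
rewrite sum_gt (eq_bigr (fun j' : 'I_n => 2 * (j < j')%:R + (j' == j :> nat)%:R *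
   (if k <= t j then t j - k else 5 - k)%N%:R)) => [|j' _].
  rewrite big_split -mulr_sumr sum_gt sum_pick_ord /= subSS.
  have -> : (n - j = (n - j.+1).+1)%N by have := ltn_ord j; lia.
  by rewrite -natr1; ring.
rewrite big_split sumr_const card_ord -mulr_sumr (eq_sym (j' : nat)).
congr (_ + _); first by rewrite /=; field.
by case: eqP => [/val_inj<-|_]; rewrite ?mul0r // -sum_new_beyond.
Qed.

Lemma sum_total_flow : \sum_e total_flow e ^+ 2 =
  \sum_(j < n) (6 * (3 * (n - j.+1)%:R) ^+ 2 + 72 * (n - j.+1)%:R + 28) +
  \sum_(j < n) (6 * (n - j.+1)%:R + 8) * excess j ^+ 2.
Proof.
rewrite sum_arc big_ord_recr /= total_flow_rung ltnn mul0r oppr0 expr0n addr0.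
rewrite -!big_split; apply: eq_bigr => j _ /=; rewrite total_flow_rung /= ltn_ord /= mul1r.
under eq_bigr do rewrite total_flow_path.
move: (n - j.+1)%:R => H; rewrite /excess.
case: (t j) => [[|[|[|[|[|m]]]]] //= _];
  by rewrite !big_ord_recl big_ord0 /= /bump /= ?subSS ?subn0; ring.
Qed.

(** Each of the [6 * (n - l.+1) + 2] vertices beyond square [l] contributes [excess l], and the new
    vertices of square [l] together contribute six times that. Those of square [l.+1] add the
    negative term through their joining rung. *)
Lemma total_overlapE (l : 'I_n) : total_overlap l =
  (6 * (n - l.+1)%:R + 8) * excess l - \sum_(j < n) (l.+1 == j)%:R * excess j.
Proof.
rewrite /total_overlap sum_vertex.
rewrite (eq_bigr (fun i : 'I_n.+1 => 2 * excess l * (l < i)%:R)) => [|i _]; last first.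
  by rewrite /overlap /sg /=; ring.
rewrite -mulr_sumr sum_gt subSS.
rewrite (eq_bigr (fun j : 'I_n => 4 * excess l * (l < j)%:R + (j == l :> nat)%:R * (6 * excess j)
   - (l.+1 == j)%:R * excess j)) => [|j _].
  rewrite sumrB big_split -mulr_sumr sum_gt (@sum_pick_ord _ (fun j : 'I_n => 6 * excess j)) /=.
  have -> : (n - l = (n - l.+1).+1)%N by have := ltn_ord l; lia.
  by rewrite -natr1; ring.
rewrite /overlap sumrB big_split /= sumr_const card_ord -!mulr_suml.
by rewrite sum_new_sg_pos sum_new_sg (eq_sym (l : nat)); field.
Qed.

(** Summation by parts: the shift from [excess l.+1] is moved onto [F]. Doing this in both indices
    turns [green] into [coupling]. *)
Lemma total_overlap_pair (F : nat -> R) : F 0 = 0 ->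
  \sum_(l < n) total_overlap l * F l.+1 =
  \sum_(l < n) excess l * ((6 * (n - l.+1)%:R + 8) * F l.+1 - F l).
Proof.
move=> F0; under eq_bigr do rewrite total_overlapE mulrBl mulr_suml.
rewrite sumrB exchange_big -sumrB; apply: eq_bigr => l _ /=.
rewrite [RHS]mulrBr; congr (_ - _); first by ring.
rewrite (eq_bigr (fun i : 'I_n => excess l * ((i.+1 == l)%:R * F i.+1))) => [|i _]; last by ring.
rewrite -mulr_sumr; congr (_ * _); case: l => -[|l] ln /=.
  by rewrite big1 ?F0 // => i _; rewrite mul0r.
by rewrite (sum_pick n (fun i => F i.+1)) ltnW //= mul1r.
Qed.

Definition coupling (l l' : nat) : R :=
  (6 * (n - l.+1)%:R + 8) * ((6 * (n - l'.+1)%:R + 8) * green l.+1 l'.+1 - green l.+1 l')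
  - ((6 * (n - l'.+1)%:R + 8) * green l l'.+1 - green l l').

Lemma total_overlap_form :
  \sum_(l < n) \sum_(l' < n) total_overlap l * (total_overlap l' * green l.+1 l'.+1) =
  \sum_(l < n) \sum_(l' < n) excess l * excess l' * coupling l l'.
Proof.
under eq_bigr do rewrite -mulr_sumr.
pose F a := \sum_(l' < n) total_overlap l' * green a l'.+1.
rewrite (total_overlap_pair (F := F)) {}/F; last first.
  by apply: big1 => l' _; rewrite green0 mulr0.
apply: eq_bigr => l _.
rewrite !(total_overlap_pair (F := fun b => green _ b)) ?(greenC _ _ _ 0) ?green0 //.
rewrite mulr_sumr -sumrB mulr_sumr; apply: eq_bigr => l' _.
by rewrite /coupling; ring.
Qed.

(** The share of the squares before [J] in [green_overlap x a], for [x] with [square_of x = J]. *)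
Definition before (J a : nat) : R := \sum_(l < n) (l < J)%:R * (excess l * green a l.+1).

Lemma overlap_form x (b := (pos x)%:R + 1 / 2 : R) (J := square_of x) :
  \sum_(l < n) overlap x l * green_overlap x l.+1 =
  \sum_(l < n) (l < J)%:R * (excess l * before J l.+1)
  + 2 * (sg (side x) * b) * before J J.+1 - sg (side x) * before J J
  + (b ^+ 2 * green J.+1 J.+1 - b * green J J.+1 + 1 / 4 * green J J).
Proof.
have Jn : (J <= n)%N := square_of_le x.
have GE a : (a <= n.+1)%N -> green_overlap x a =
    before J a + sg (side x) * b * green a J.+1 - sg (side x) / 2 * green a J.
  move=> an; rewrite /green_overlap overlap_pair; last by rewrite greenC greenS.
    by congr (_ + _ - _); apply: eq_bigr => l _; rewrite mulrA.
  by rewrite greenC green0.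
rewrite overlap_pair ?green_overlap0 ?green_overlapS // -/J -/b.
rewrite (GE J) ?(GE J.+1) //; last exact: leqW.
rewrite (eq_bigr (fun l : 'I_n => (l < J)%:R * (excess l * before J l.+1) +
  (sg (side x) * b * ((l < J)%:R * (excess l * green J.+1 l.+1))
   - sg (side x) / 2 * ((l < J)%:R * (excess l * green J l.+1))))); last first.
  by move=> l _; rewrite GE ?(greenC _ _ l.+1) //; [ring | apply: leqW; apply: ltn_ord].
rewrite big_split sumrB -!mulr_sumr -/(before J J.+1) -/(before J J) (greenC _ _ J.+1 J).
move: (before J J.+1) (before J J) (\sum_(i < n) _) => B1 B0 S.
by rewrite /sg; case: (side x) => /=; field.
Qed.

(** The first term counts the vertices beyond both squares, the others come from the new vertices of
    square [l]. The coefficient is left asymmetric; only its symmetric part affects the form. *)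
Definition overlap_coef (l l' : nat) : R :=
  (6 * (n - (maxn l l').+1)%:R + 2) * green l.+1 l'.+1 +
  (l' < l)%:R * (12 * green l.+1 l'.+1 - 2 * green l l'.+1) +
  (l == l')%:R * (6 * green l.+1 l.+1 - green l l.+1).

Definition overlap_const : R :=
  \sum_(i < n.+1) (1 / 2 * green i.+1 i.+1 - green i i.+1 + 1 / 2 * green i i) +
  \sum_(j < n) (17 * green j.+1 j.+1 - 8 * green j j.+1 + green j j).

Lemma sum_before m : \sum_(J < m) \sum_(l < n) (l < J)%:R * (excess l * before J l.+1) =
  \sum_(l < n) \sum_(l' < n) excess l * excess l' * ((m - (maxn l l').+1)%:R * green l.+1 l'.+1).
Proof.
rewrite exchange_big; apply: eq_bigr => l _ /=.
under eq_bigr do rewrite /before !mulr_sumr.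
rewrite exchange_big; apply: eq_bigr => l' _ /=.
rewrite -sum_gt mulr_suml mulr_sumr; apply: eq_bigr => J _.
by rewrite gtn_max -mulnb natrM; ring.
Qed.

Lemma sum_overlap_form : \sum_x \sum_(l < n) overlap x l * green_overlap x l.+1 =
  overlap_const + \sum_(l < n) \sum_(l' < n) excess l * excess l' * overlap_coef l l'.
Proof.
under eq_bigr do rewrite overlap_form.
rewrite sum_vertex /=.
set W := fun J => \sum_(l < n) (l < J)%:R * (excess l * before J l.+1).
rewrite (eq_bigr (fun i : 'I_n.+1 => 2 * W i +
  (1 / 2 * green i.+1 i.+1 - green i i.+1 + 1 / 2 * green i i))); last first.
  by move=> i _; rewrite -/(W i) /sg; field.
rewrite [X in _ + X = _](eq_bigr (fun j : 'I_n => 4 * W j +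
  (12 * excess j * before j j.+1 - 2 * excess j * before j j
   + excess j ^+ 2 * (6 * green j.+1 j.+1 - green j j.+1)) +
  (17 * green j.+1 j.+1 - 8 * green j j.+1 + green j j))); last first.
  move=> j _.
  (* The summand is regrouped as a combination of the four moments of the new vertices. *)
  have E (k : 'I_4) :
    W j + 2 * (sg (side (new_vertex j k)) * ((pos (new_vertex j k))%:R + 1 / 2))
      * before j j.+1
     - sg (side (new_vertex j k)) * before j j +
     (((pos (new_vertex j k))%:R + 1 / 2) ^+ 2 * green j.+1 j.+1
      - ((pos (new_vertex j k))%:R + 1 / 2) * green j j.+1 + 1 / 4 * green j j) =
    W j + 2 * before j j.+1 * (sg (side (new_vertex j k)) * ((pos (new_vertex j k))%:R + 1 / 2))
    + - before j j * sg (side (new_vertex j k)) +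
    (green j.+1 j.+1 * ((pos (new_vertex j k))%:R + 1 / 2) ^+ 2
    + - green j j.+1 * (pos (new_vertex j k))%:R + (1 / 4 * green j j - 1 / 2 * green j j.+1)).
    by field.
  rewrite (eq_bigr _ (fun k _ => E k)) !big_split /= !sumr_const card_ord -!mulr_sumr.
  by rewrite sum_new_sg_pos sum_new_sg sum_new_pos2 sum_new_pos; field.
rewrite !big_split /= -!mulr_sumr /W !sum_before /overlap_const !big_split /=.
rewrite -!mulr_sumr.
have E : \sum_(l < n) \sum_(l' < n) excess l * excess l' * overlap_coef l l' =
  2 * (\sum_(l < n) \sum_(l' < n)
      excess l * excess l' * ((n.+1 - (maxn l l').+1)%:R * green l.+1 l'.+1)) +
  4 * (\sum_(l < n) \sum_(l' < n)
      excess l * excess l' * ((n - (maxn l l').+1)%:R * green l.+1 l'.+1)) +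
  (\sum_(i < n) 12 * excess i * before i i.+1 +
   \sum_(i < n) - (2 * excess i * before i i) +
   \sum_(i < n) excess i ^+ 2 * (6 * green i.+1 i.+1 - green i i.+1)); last by rewrite E; ring.
rewrite !mulr_sumr -!big_split; apply: eq_bigr => l _ /=.
rewrite /before -mulNr !mulr_sumr.
have -> : excess l ^+ 2 * (6 * green l.+1 l.+1 - green l l.+1) =
   \sum_(l' < n) (l' == l :> nat)%:R *
     (excess l * excess l' * (6 * green l.+1 l.+1 - green l l.+1)).
  by rewrite (@sum_pick_ord _ (fun l' : 'I_n => excess l * excess l' * _)) expr2.
rewrite -!big_split; apply: eq_bigr => l' _ /=.
have -> : (n.+1 - (maxn l l').+1 = (n - (maxn l l').+1).+1)%N.
  by have := ltn_ord l; have := ltn_ord l'; lia.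
rewrite /overlap_coef (eq_sym (l : nat)) -natr1; ring.
Qed.

(** The coefficient of [excess l * excess l'] in the Kirchhoff index, minus the claimed one, which
    comes from [- wt_form / cheb n.+1]. *)
Definition form_coef (l l' : nat) : R :=
  (l == l')%:R * ((6 * n + 2)%:R - (6 * (n - l.+1)%:R + 8))
  - (6 * n + 2)%:R * overlap_coef l l' + coupling l l'
  + wt R (minn l l') * wt R (n.-1 - maxn l l') / cheb R n.+1.

(** For i < j all terms share the denominator [cheb n.+1], and the recurrence reduces the claim to a
    ring identity. For i = j one term lacks this denominator, and [chebD] is needed. *)
Lemma form_coef_antisym i j : (i < n)%N -> (j < n)%N -> form_coef i j + form_coef j i = 0.
Proof.
wlog ij : i j / (i <= j)%N => [wl iltn jltn|_ jltn].
  by case: (leqP i j) => [|/ltnW] ij; [apply: wl | rewrite addrC; apply: wl].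
have c0 : cheb R n.+1 != 0 by rewrite gt_eqF ?cheb_gt0.
have nE : n = (j.+1 + (n - j.+1))%N by lia.
have n1 : (n.-1 - j = n - j.+1)%N by lia.
have n2 : (n.+1 - j = (n - j.+1).+2)%N by lia.
have n3 : (n.+1 - j.+1 = (n - j.+1).+1)%N by lia.
rewrite /form_coef /overlap_coef /coupling (maxnC j) (minnC j) (minn_idPl ij) (maxn_idPr ij) n1.
have [ij'|ji|eij] := ltngtP i j; last 1 first.
- rewrite -{j ij}eij in jltn nE n1 n2 n3 *.
  rewrite /= (greenC _ _ i.+1 i) !green_le ?n2 ?n3 // chebSS /wt.
  have cE : cheb R n.+1 = cheb R i.+2 * cheb R (n - i.+1).+1 - cheb R i.+1 * cheb R (n - i.+1).
    by rewrite chebD addSn; congr cheb; lia.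
  have mE : (6 * n + 2)%:R = 6 * i%:R + 6 * (n - i.+1)%:R + 8 :> R.
    by rewrite {1}nE; rewrite !(natrM, natrD) -natr1; ring.
  rewrite mE natrM; move: (n - i.+1)%N cE => k; rewrite chebSS.
  move: (cheb R n.+1) c0 => c c0 cE.
  move: (c^-1) (divff c0) => d cd.
  (* The term without denominator is multiplied by [c * d = 1], so that [c] can be expanded by
     [cE]. *)
  have -> : 6 * i%:R + 6 * k%:R + 8 - (6 * k%:R + 8) = 6 * i%:R * (c * d) by rewrite cd; ring.
  by rewrite /= cE natrM; ring.
- have iE : n = (i.+1 + (j - i) + (n - j.+1))%N by lia.
  have -> : (n - i.+1 = (j - i) + (n - j.+1))%N by lia.
  rewrite /= (greenC _ _ j.+1 i.+1) (greenC _ _ j i.+1) (greenC _ _ j.+1 i) (greenC _ _ j i).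
  rewrite !green_le ?n2 ?n3 ?(leqW ij) // chebSS /wt.
  have -> : (6 * n + 2)%:R = 6 * i%:R + 6 * (j - i)%:R + 6 * (n - j.+1)%:R + 8 :> R.
    by rewrite {1}iE !(natrM, natrD) -natr1; ring.
  move: (n - j.+1)%N (cheb R n.+1)^-1 => k d; rewrite !natrD ?natrM; ring.
by lia.
Qed.

Lemma antisym_form (z : nat -> R) (B : nat -> nat -> R) :
  (forall i j, (i < n)%N -> (j < n)%N -> B i j + B j i = 0) ->
  \sum_(i < n) \sum_(j < n) z i * z j * B i j = 0.
Proof.
move=> B0; set S := (X in X = 0); have : S + S = 0.
  rewrite {2}/S exchange_big -big_split big1 // => i _ /=.
  rewrite -big_split big1 // => j _ /=.
  by rewrite [z j * z i]mulrC -mulrDr B0 ?mulr0.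
by lra.
Qed.

(** The terms quadratic in the excess equal the last one up to an antisymmetric coefficient matrix,
    whose form is zero. Only the last term depends on the shape of the chain. *)
Lemma kirchhoff_index_excess : kirchhoff_index R (subdivided_ladder tops) =
  (6 * n + 2)%:R *
    (\sum_(i < n.+1) (1 / 2 + 3 * i%:R) + \sum_(j < n) (7 + 6 * j%:R) - overlap_const)
  - \sum_(j < n) (6 * (3 * (n - j.+1)%:R) ^+ 2 + 72 * (n - j.+1)%:R + 28)
  - wt_form n excess / cheb R n.+1.
Proof.
rewrite kirchhoff_index_flow sum_flow_energy sum_overlap_form sum_total_flow total_overlap_form.
have := antisym_form excess form_coef_antisym.
rewrite (eq_bigr (fun l : 'I_n => excess l ^+ 2 * (6 * n + 2)%:R
     - (6 * (n - l.+1)%:R + 8) * excess l ^+ 2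
  - (6 * n + 2)%:R * (\sum_(l' < n) excess l * excess l' * overlap_coef l l')
  + \sum_(l' < n) excess l * excess l' * coupling l l' +
  (\sum_(l' < n) excess l * excess l' * (wt R (minn l l') * wt R (n.-1 - maxn l l')))
    / cheb R n.+1)).
  by rewrite !big_split !sumrN -!mulr_suml -!mulr_sumr /= /wt_form; lra.
move=> l _; rewrite mulr_sumr mulr_suml.
have -> : excess l ^+ 2 * (6 * n + 2)%:R - (6 * (n - l.+1)%:R + 8) * excess l ^+ 2 =
   \sum_(l' < n) (l' == l :> nat)%:R *
     (excess l * excess l' * ((6 * n + 2)%:R - (6 * (n - l.+1)%:R + 8))).
  by rewrite (@sum_pick_ord _ (fun l' : 'I_n => excess l * excess l' * _)); ring.
rewrite -sumrB -!big_split; apply: eq_bigr => l' _ /=.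
rewrite /form_coef (eq_sym (l : nat)); ring.
Qed.

End Flow.

(** * Comparison with the linear chain *)

Theorem theorem1 (R : realFieldType) (n : nat) (n_ge2 : (2 <= n)%N)
    (w : (n - 2).-tuple 'I_5) :
  kirchhoff_index R (octagonal_chain n w) <= kirchhoff_index R (linear_chain n)
  /\ (kirchhoff_index R (octagonal_chain n w) = kirchhoff_index R (linear_chain n) ->
      isomorphic (octagonal_chain n w) (linear_chain n)).
Proof.
pose t (v : (n - 2).-tuple 'I_5) (j : nat) := nth ord0 (ord0 :: rcons v ord0) j.
have kfE v := kirchhoff_index_excess R n (t v).
have kf_chain v : kirchhoff_index R (octagonal_chain n v) =
    kirchhoff_index R (subdivided_ladder (fun j : 'I_n => t v j)) by [].
rewrite /linear_chain !kf_chain !kfE; set two := nseq_tuple _ _.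
have t_inner v i : (i < n - 2)%N -> t v i.+1 = nth ord0 v i.
  by move=> ilt; rewrite /t /= nth_rcons size_tuple ilt.
(* The inner squares of the linear chain have excess 0; the first and last have excess -2, but
   [wt_form_eq0] asks only for the inner ones. *)
have two0 : wt_form n (excess R (t two)) = 0.
  apply/wt_form_eq0 => // -[|i] // ilt; rewrite /excess t_inner; last by lia.
  by rewrite nth_nseq ifT ?subrr //; lia.
have c_gt0 : 0 < cheb R n.+1 := cheb_gt0 R n.
rewrite two0 mul0r subr0; split.
  by rewrite lerBlDr lerDl divr_ge0 ?wt_form_ge0 // ltW.
move=> eq_kf; have : wt_form n (excess R (t w)) / cheb R n.+1 = 0 by lra.
move/eqP; rewrite mulf_eq0 invr_eq0 [_ == 0 in X in _ || X]gt_eqF // orbF => /eqP.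
move/(wt_form_eq0 _ n_ge2) => w0.
(* Equality forces even the vectors to coincide, so the identity map is the isomorphism. *)
suff -> : w = two by exists id => //; exists id.
apply: val_inj; apply: (@eq_from_nth _ ord0); rewrite !size_tuple // => i ilt.
rewrite nth_nseq ilt -t_inner //; apply: val_inj => /=.
have : excess R (t w) i.+1 = 0 by apply: w0; lia.
by rewrite /excess => /eqP; rewrite subr_eq0 eqr_nat => /eqP.
Qed.
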